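(* Let $A\in\mathbb{K}[t,\sigma]^{m\times m}$ be a regular matrix. The $t$-trailing desingularisation procedure described in the context, applied to $A$, is correct and terminates: after finitely many steps it returns a matrix $B\in\mathbb{K}[t,\sigma]^{m\times m}$ that is equivalent to $A$ (that is, $B=UA$ for some $U\in\mathrm{GL}_m(\mathbb{K}(t)[\sigma])$) and whose $t$-trailing matrix is regular (that is, has nonzero determinant in $\mathbb{K}[\sigma]$).
   Context: **Setting.** $\mathbb{K}$ is a field of characteristic $0$, $q\in\mathbb{K}\setminus\{0\}$ is not a root of unity, $t$ is an indeterminate. $\mathbb{K}[t,\sigma]$ is the ring of skew polynomials in $\sigma$ with coefficients in $\mathbb{K}[t]$ (written on the left), with the usual addition and with multiplication determined by $\sigma t=qt\sigma$, where $\sigma$ commutes with elements of $\mathbb{K}$. $\mathbb{K}(t)[\sigma]\supseteq\mathbb{K}[t,\sigma]$ is the analogous ring with coefficients in $\mathbb{K}(t)$ (so $\sigma t^{-1}=q^{-1}t^{-1}\sigma$). The subring $\mathbb{K}[\sigma]$ is an ordinary commutative univariate polynomial ring. $\mathrm{GL}_m(R)$ denotes the group of matrices in $R^{m\times m}$ having an inverse in $R^{m\times m}$ (unimodular matrices). A matrix in $\mathbb{K}[t,\sigma]^{m\times m}$ is regular if its rows are left linearly independent over $\mathbb{K}(t)[\sigma]$; a square matrix over $\mathbb{K}[\sigma]$ is regular if it has full rank over $\mathbb{K}[\sigma]$, i.e. nonzero determinant. Two matrices $A,B$ are equivalent if $B=UA$ with $U\in\mathrm{GL}_m(\mathbb{K}(t)[\sigma])$.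 **$t$-trailing matrix.** Every $A\in\mathbb{K}[t,\sigma]^{m\times m}$ can be written uniquely as $A=t^\ell\tilde A_\ell+\ldots+t\tilde A_1+\tilde A_0$ with $\tilde A_i\in\mathbb{K}[\sigma]^{m\times m}$; $\tilde A_0$ is the $t$-trailing matrix of $A$. **Popov normal form.** Let $e_i$ be the $i$-th unit row vector. The term over position ordering on monomials $e_i\sigma^a$ of $\mathbb{K}[\sigma]^{1\times m}$ is: $e_i\sigma^a\leq e_j\sigma^b$ iff $a<b$, or $a=b$ and $i\geq j$. A matrix over $\mathbb{K}[\sigma]$ is in Popov normal form if its rows form a minimal Gröbner basis (of the module they generate) with respect to this ordering. For every $M\in\mathbb{K}[\sigma]^{m\times m}$ there is $X\in\mathrm{GL}_m(\mathbb{K}[\sigma])$ such that $XM=\begin{pmatrix}P\\ \mathbf{0}\end{pmatrix}$ with $P$ in Popov normal form, and the number of rows of $P$ is the rank of $M$. Gröbner basis division of the rows of a matrix $C$ by the rows of $P$ gives $C=XP+Y$ with matrices $X,Y$ over $\mathbb{K}[\sigma]$ such that no row of $Y$ is reducible by $P$; a row of $Y$ is zero if the corresponding row of $C$ lies in the row module of $P$. **Procedure.** Input: a regular $A\in\mathbb{K}[t,\sigma]^{m\times m}$. 1. Compute the $t$-trailing matrix $\tilde A_0$ of $A$. If $\det\tilde A_0\neq 0$, return $A$. 2. Else compute the Popov normal form of $\tilde A_0$, with corresponding transformation matrix $X\in\mathrm{GL}_m(\mathbb{K}[\sigma])$, and let $r$ be the rank of $\tilde A_0$. Set $A\leftarrow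 XA$; the new $t$-trailing matrix is $\begin{pmatrix}\tilde B_0\\ \mathbf{0}\end{pmatrix}$ with $\tilde B_0\in\mathbb{K}[\sigma]^{r\times m}$ in Popov normal form. 3. Let $T=\mathrm{diag}(\mathbf{1}_r,t^{-1}\mathbf{1}_{m-r})$ and set $A\leftarrow TA$. The new $t$-trailing matrix is $\begin{pmatrix}\tilde B_0\\ \tilde C_0\end{pmatrix}$ with the same $\tilde B_0$ and some $\tilde C_0\in\mathbb{K}[\sigma]^{(m-r)\times m}$. 4. Reduce $\tilde C_0$ by $\tilde B_0$ by Gröbner basis division: $\tilde C_0=X\tilde B_0+Y$ with $X\in\mathbb{K}[\sigma]^{(m-r)\times r}$ and $Y\in\mathbb{K}[\sigma]^{(m-r)\times m}$. Let $Q=\begin{pmatrix}\mathbf{1}_r&\mathbf{0}\\-X&\mathbf{1}_{m-r}\end{pmatrix}$ and set $A\leftarrow QA$. 5. If $Y=\mathbf{0}$, continue with step 3. Else go back to step 1. *)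

(* Defs.v *)
From HB Require Import structures.
From mathcomp Require Import all_boot all_order all_algebra.
From Stdlib Require Export Relation_Operators.

Set Implicit Arguments.
Unset Strict Implicit.
Unset Printing Implicit Defensive.

Import GRing.Theory.
Local Open Scope ring_scope.

(* Skew polynomials: p : skewpoly s stands for \sum_i p`_i sigma^i with
   coefficients on the left and sigma * a = s a * sigma.  The additive structure
   is that of {poly R}; only the product is twisted. *)
Definition skewpoly (R : nzRingType) (s : {rmorphism R -> R}) : Type := {poly R}.

Section SkewPolyRing.
Variables (R : nzRingType) (s : {rmorphism R -> R}).
Implicit Types p r u : skewpoly s.

HB.instance Definition _ :=
  GRing.Zmodule.copy (skewpoly s) {poly R}.

Definition skewpoly_mul p r : skewpoly s :=
  \poly_(i < size p + size r) \sum_(j < i.+1) p`_j * iter j s r`_(i - j).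

Fact iter_rmorph0 n : iter n s 0 = 0.
Proof. by elim: n => //= n ->; rewrite rmorph0. Qed.

Fact iter_rmorph1 n : iter n s 1 = 1.
Proof. by elim: n => //= n ->; rewrite rmorph1. Qed.

Fact iter_rmorphD n a b : iter n s (a + b) = iter n s a + iter n s b.
Proof. by elim: n => //= n ->; rewrite rmorphD. Qed.

Fact iter_rmorphM n a b : iter n s (a * b) = iter n s a * iter n s b.
Proof. by elim: n => //= n ->; rewrite rmorphM. Qed.

Fact iter_rmorph_sum n (I : Type) (l : seq I) (P : pred I) (F : I -> R) :
  iter n s (\sum_(i <- l | P i) F i) = \sum_(i <- l | P i) iter n s (F i).
Proof. by elim: n => //= n ->; rewrite rmorph_sum. Qed.

Lemma coef_skewpoly_mul p r i :
  (skewpoly_mul p r)`_i = \sum_(j < i.+1) p`_j * iter j s r`_(i - j).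
Proof.
rewrite coef_poly; case: ltnP => // le_i; rewrite big1 // => j _.
have [lt_j | le_j] := ltnP j (size p); last by rewrite nth_default ?mul0r.
rewrite (nth_default _ (n := i - j)) ?iter_rmorph0 ?mulr0 //.
rewrite leq_subRL -1?ltnS //; apply: leq_trans le_i.
by rewrite leq_add2r ltnW.
Qed.

Fact skewpoly_mulA : associative skewpoly_mul.
Proof.
move=> p r u; apply/polyP=> i; rewrite !coef_skewpoly_mul.
pose F (j k : nat) := p`_j * iter j s r`_(k - j) * iter k s u`_(i - k).
transitivity (\sum_(j < i.+1) \sum_(k < i.+1 | (j <= k)%N) F j k).
  apply: eq_bigr => j _; rewrite coef_skewpoly_mul iter_rmorph_sum big_distrr /=.
  have le_ji : (j <= i)%N by rewrite -ltnS.
  rewrite -(big_mkord xpredT (fun k : nat =>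
    p`_j * iter j s (r`_k * iter k s u`_(i - j - k)))).
  rewrite -(big_mkord (fun k => (j <= k)%N) (fun k => F j k)).
  rewrite [RHS](big_cat_nat (leq0n j)) /=; last exact: leqW.
  rewrite [X in _ = X + _]big_nat_cond [X in _ = X + _]big_pred0 ?add0r.
    rewrite -[X in index_iota X i.+1]add0n big_addn subSn //.
    apply: eq_big => k /=; first by rewrite leq_addl.
    move=> _; rewrite /F iter_rmorphM -iterD addnK -subnDA addnC mulrA.
    by rewrite [(k + j)%N]addnC.
  by move=> k /=; case: leqP; rewrite ?andbF ?andbT.
rewrite (exchange_big_dep xpredT) //=; apply: eq_bigr => k _.
have le_ki : (k <= i)%N by rewrite -ltnS.
rewrite coef_skewpoly_mul big_distrl /= (big_ord_narrow_leq le_ki) /=.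
by apply: eq_bigr => j _.
Qed.

Fact skewpoly_mul1 : left_id (1%:P : skewpoly s) skewpoly_mul.
Proof.
move=> p; apply/polyP=> i; rewrite coef_skewpoly_mul big_ord_recl subn0 /=.
by rewrite coefC mul1r big1 ?addr0 // => j _; rewrite coefC mul0r.
Qed.

Fact skewpoly_mulr1 : right_id (1%:P : skewpoly s) skewpoly_mul.
Proof.
move=> p; apply/polyP=> i; rewrite coef_skewpoly_mul big_ord_recr subnn /=.
rewrite coefC iter_rmorph1 mulr1 big1 ?add0r // => j _.
by rewrite coefC subn_eq0 leqNgt ltn_ord iter_rmorph0 mulr0.
Qed.

Fact skewpoly_mulDl : left_distributive skewpoly_mul +%R.
Proof.
move=> p r u; apply/polyP=> i; rewrite coefD !coef_skewpoly_mul -big_split.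
by apply: eq_bigr => j _; rewrite coefD mulrDl.
Qed.

Fact skewpoly_mulDr : right_distributive skewpoly_mul +%R.
Proof.
move=> p r u; apply/polyP=> i; rewrite coefD !coef_skewpoly_mul -big_split.
by apply: eq_bigr => j _; rewrite coefD iter_rmorphD mulrDr.
Qed.

Fact skewpoly_oner_neq0 : (1%:P : skewpoly s) != 0.
Proof. by rewrite polyC_eq0 oner_eq0. Qed.

HB.instance Definition _ := GRing.Zmodule_isNzRing.Build (skewpoly s)
  skewpoly_mulA skewpoly_mul1 skewpoly_mulr1 skewpoly_mulDl skewpoly_mulDr
  skewpoly_oner_neq0.

Definition skewC (a : R) : skewpoly s := a%:P.
Definition sigma : skewpoly s := 'X.

Lemma sigma_skewC a : sigma * skewC a = skewC (s a) * sigma.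
Proof.
apply/polyP=> i; rewrite !coef_skewpoly_mul /sigma /skewC.
case: i => [|i]; first by rewrite !big_ord1 !coefX /= mul0r mulr0.
rewrite (bigD1 (1 : 'I_i.+2)) //= [RHS]big_ord_recl /= subn0.
rewrite [X in _ + X = _]big1 => [|j neq_j1]; last first.
  by rewrite coefX -val_eqE /= in neq_j1 *; rewrite (negPf neq_j1) mul0r.
rewrite [X in _ = _ + X]big1 => [|j _]; last by rewrite coefC mul0r.
rewrite !addr0 !coefX !coefC /= mul1r subSS subn0 eqSS.
by case: eqP; rewrite ?mulr1 ?mulr0 ?rmorph0.
Qed.

End SkewPolyRing.

Notation tofrac := (@FracField.tofrac _).

Section FracLift.
Variables (R : idomainType) (F : fieldType) (f : {rmorphism R -> F}).
Hypothesis f_inj : injective f.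

(* The extension n / d |-> f n / f d of f to the fraction field. *)
Definition frac_lift of injective f := fun x : {fraction R} =>
  f \n_(repr x) / f \d_(repr x).

Lemma frac_reprE (x : {fraction R}) :
  x = tofrac \n_(repr x) / tofrac \d_(repr x).
Proof.
have nzd : tofrac \d_(repr x) != 0 by rewrite tofrac_eq0 denom_ratioP.
apply: (canRL (mulfK nzd)); rewrite -{1}[x]reprK; unlock FracField.tofrac.
rewrite -[LHS]FracField.pi_mul; apply/eqmodP => /=; rewrite FracField.equivfE.
by rewrite /FracField.mulf !numden_Ratio ?mulr1 ?oner_neq0 ?denom_ratioP // mulrC.
Qed.

Lemma frac_liftE n d : d != 0 ->
  frac_lift f_inj (tofrac n / tofrac d) = f n / f d.
Proof.
move=> nzd; rewrite /frac_lift; set x := (X in repr X).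
have nzf c : c != 0 -> f c != 0 by rewrite -(inj_eq f_inj) rmorph0.
have nzx := denom_ratioP (repr x).
apply/eqP; rewrite eqr_div ?nzf // -!rmorphM (inj_eq f_inj) -tofrac_eq !tofracM.
by rewrite -eqr_div ?tofrac_eq0 // -frac_reprE.
Qed.

Lemma frac_lift_tofrac n : frac_lift f_inj (tofrac n) = f n.
Proof.
by have := frac_liftE n (oner_neq0 R); rewrite tofrac1 rmorph1 !divr1.
Qed.

Fact frac_lift_is_zmod_morphism : zmod_morphism (frac_lift f_inj).
Proof.
move=> x y; rewrite {1}[x]frac_reprE {1}[y]frac_reprE.
have nzx := denom_ratioP (repr x); have nzy := denom_ratioP (repr y).
have nzf c : c != 0 -> f c != 0 by rewrite -(inj_eq f_inj) rmorph0.
rewrite -mulNr addf_div ?tofrac_eq0 // -tofracN -!tofracM -tofracD.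
rewrite frac_liftE ?mulf_neq0 // !(rmorphD, rmorphM, rmorphN) /=.
by rewrite -addf_div ?nzf // mulNr.
Qed.

Fact frac_lift_is_monoid_morphism : monoid_morphism (frac_lift f_inj).
Proof.
split=> [|x y].
  have -> : 1 = tofrac 1 / tofrac 1 :> {fraction R} by rewrite tofrac1 divr1.
  by rewrite frac_liftE ?oner_neq0 // rmorph1 divr1.
rewrite {1}[x]frac_reprE {1}[y]frac_reprE mulf_div -!tofracM.
by rewrite frac_liftE ?mulf_neq0 ?denom_ratioP // !rmorphM -mulf_div.
Qed.

HB.instance Definition _ := GRing.isZmodMorphism.Build {fraction R} F
  (frac_lift f_inj) frac_lift_is_zmod_morphism.
HB.instance Definition _ := GRing.isMonoidMorphism.Build {fraction R} F
  (frac_lift f_inj) frac_lift_is_monoid_morphism.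

End FracLift.

Section QShift.
Variables (K : fieldType) (q : K).

(* The automorphism t |-> q t of K[t]. *)
Definition qshift : {rmorphism {poly K} -> {poly K}} := comp_poly (q *: 'X).

Definition qshift_frac : {rmorphism {poly K} -> {fraction {poly K}}} :=
  tofrac \o qshift.

Fact qshift_frac_inj : q != 0 -> injective qshift_frac.
Proof.
move=> q0 p r /eqP; rewrite /= tofrac_eq => /eqP eq_pr.
have qK : cancel (comp_poly (q *: 'X)) (comp_poly (q^-1 *: 'X)).
  move=> u; rewrite -comp_polyA comp_polyZ comp_polyX scalerA divff // scale1r.
  exact: comp_polyXr.
exact: (can_inj qK).
Qed.

(* K[t, sigma] and, for q != 0, K(t)[sigma]. *)
Definition skew_t := skewpoly qshift.
Definition skew_frac (q0 : q != 0) :=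
  skewpoly (frac_lift (qshift_frac_inj q0) : {rmorphism _ -> _}).

HB.instance Definition _ := GRing.NzRing.copy skew_t (skewpoly qshift).
HB.instance Definition _ q0 := GRing.NzRing.copy (skew_frac q0)
  (skewpoly (frac_lift (qshift_frac_inj q0) : {rmorphism _ -> _})).

Definition skew_t_frac (q0 : q != 0) (a : skew_t) : skew_frac q0 :=
  map_poly tofrac a.

(* K[sigma] is the commutative ring {poly K}, with sigma in the role of 'X. *)
Definition skew_const (p : {poly K}) : skew_t := map_poly polyC p.

(* tcoef i a is the coefficient in K[sigma] of t^i when a is written with the
   powers of t on the left. *)
Definition tcoef (i : nat) (a : skew_t) : {poly K} :=
  \poly_(j < size a) (a`_j)`_i.

Definition t_trailing m (A : 'M[skew_t]_m) : 'M[{poly K}]_m :=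
  map_mx (tcoef 0) A.

End QShift.

Definition GL (R : nzRingType) m (U : 'M[R]_m) : Prop :=
  exists V : 'M[R]_m, U *m V = 1%:M /\ V *m U = 1%:M.

Definition left_independent_rows (R : nzRingType) m n (A : 'M[R]_(m, n)) :=
  forall v : 'rV[R]_m, v *m A = 0 -> v = 0.

Section Groebner.
Variable K : fieldType.

(* (i, a) stands for the monomial e_i sigma^a. *)
Definition monom m := ('I_m * nat)%type.

Definition top_le m (u v : monom m) : bool :=
  (u.2 < v.2)%N || (u.2 == v.2) && (v.1 <= u.1)%N.

Definition mdvd m (u v : monom m) : bool :=
  (u.1 == v.1) && (u.2 <= v.2)%N.

Definition in_support m (f : 'rV[{poly K}]_m) (u : monom m) : bool :=
  (f 0 u.1)`_(u.2) != 0.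

Definition is_lead_monom m (f : 'rV[{poly K}]_m) (u : monom m) : Prop :=
  in_support f u /\ forall v, in_support f v -> top_le v u.

Definition groebner_basis r m (P : 'M[{poly K}]_(r, m)) : Prop :=
  forall (c : 'rV[{poly K}]_r) (u : monom m), is_lead_monom (c *m P) u ->
  exists (i : 'I_r) (v : monom m), is_lead_monom (row i P) v /\ mdvd v u.

(* Minimality: no row is zero and no leading monomial divides that of another
   row.  Leading coefficients are not normalised to 1. *)
Definition popov_form r m (P : 'M[{poly K}]_(r, m)) : Prop :=
  [/\ groebner_basis P,
      forall i, row i P != 0
    & forall i j u v, i != j ->
        is_lead_monom (row i P) u -> is_lead_monom (row j P) v -> ~~ mdvd u v].

Definition reducible r m (P : 'M[{poly K}]_(r, m)) (y : 'rV[{poly K}]_m) :=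
  exists (i : 'I_r) (u v : monom m),
    [/\ is_lead_monom (row i P) v, in_support y u & mdvd v u].

(* The rank over K[sigma] is the rank over its field of fractions. *)
Definition poly_rank m n (M : 'M[{poly K}]_(m, n)) : nat :=
  \rank (map_mx tofrac M).

End Groebner.

(* Blocks of sizes r and s reassembled at size m = r + s. *)
Definition stack_mx (R : Type) r s m n (e : (r + s)%N = m)
    (P : 'M[R]_(r, n)) (N : 'M[R]_(s, n)) : 'M[R]_(m, n) :=
  castmx (e, erefl n) (col_mx P N).

Definition square_block_mx (R : Type) r s m (e : (r + s)%N = m)
    (Aul : 'M[R]_(r, r)) (Aur : 'M[R]_(r, s))
    (Adl : 'M[R]_(s, r)) (Adr : 'M[R]_(s, s)) : 'M[R]_m :=
  castmx (e, e) (block_mx Aul Aur Adl Adr).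

Section Procedure.
Variables (K : fieldType) (q : K) (q0 : q != 0) (m : nat).

Local Notation Kts := (skew_t q).
Local Notation Ktfs := (skew_frac q0).

Definition equivalent_mx (A B : 'M[Kts]_m) : Prop :=
  exists U : 'M[Ktfs]_m,
    GL U /\ map_mx (skew_t_frac q0) B = U *m map_mx (skew_t_frac q0) A.

Definition regular_mx (A : 'M[Kts]_m) : Prop :=
  left_independent_rows (map_mx (skew_t_frac q0) A).

(* A configuration is the point reached in the procedure together with the
   current matrix and, inside the inner loop, the number r of rows of the
   Popov form.  Test_trailing: about to run step 1; Shift_rows: about to run
   step 3; Reduce_rows: about to run step 4; Return: finished. *)
Inductive config : Type :=
  | Test_trailing of 'M[Kts]_m
  | Shift_rows of nat & 'M[Kts]_m
  | Reduce_rows of nat & 'M[Kts]_m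
  | Return of 'M[Kts]_m.

Definition t_inv : Ktfs := skewC _ (tofrac 'X)^-1.

Definition shift_mx r s (e : (r + s)%N = m) : 'M[Ktfs]_m :=
  square_block_mx e 1%:M 0 0 (t_inv%:M).

Definition reduction_mx r s (e : (r + s)%N = m) (X : 'M[{poly K}]_(s, r)) :
    'M[Kts]_m :=
  square_block_mx e 1%:M 0 (- map_mx (skew_const q) X) 1%:M.

(* step is a relation because the Popov form and its transformation matrix
   are not unique. *)
Inductive step : config -> config -> Prop :=
  | step_return (A : 'M[Kts]_m) :
      \det (t_trailing A) != 0 ->
      step (Test_trailing A) (Return A)
  | step_popov (A : 'M[Kts]_m) r s (e : (r + s)%N = m)
      (P : 'M[{poly K}]_(r, m)) (X : 'M[{poly K}]_m) :
      \det (t_trailing A) = 0 ->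
      r = poly_rank (t_trailing A) ->
      popov_form P ->
      X \in unitmx ->
      X *m t_trailing A = stack_mx e P 0 ->
      step (Test_trailing A) (Shift_rows r (map_mx (skew_const q) X *m A))
  | step_shift (A A' : 'M[Kts]_m) r s (e : (r + s)%N = m) :
      map_mx (skew_t_frac q0) A' = shift_mx e *m map_mx (skew_t_frac q0) A ->
      step (Shift_rows r A) (Reduce_rows r A')
  | step_reduce (A : 'M[Kts]_m) r s (e : (r + s)%N = m)
      (B0 : 'M[{poly K}]_(r, m)) (C0 Y : 'M[{poly K}]_(s, m))
      (X : 'M[{poly K}]_(s, r)) :
      t_trailing A = stack_mx e B0 C0 ->
      C0 = X *m B0 + Y ->
      (forall i, ~ reducible B0 (row i Y)) ->
      step (Reduce_rows r A)
        (if Y == 0 then Shift_rows r (reduction_mx e X *m A)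
         else Test_trailing (reduction_mx e X *m A)).

Definition reachable : config -> config -> Prop := clos_refl_trans config step.

(* Every run from c is finite. *)
Definition terminates (c : config) : Prop := Acc (fun c2 c1 => step c1 c2) c.

End Procedure.

(* Main.v *)
Require Import Defs.
From HB Require Import structures.
From mathcomp Require Import all_boot all_order perm all_algebra.

(* Termination.  Only the shift by T enlarges the row module, and no step raises
   the degree D of the matrix in t, since all multipliers have coefficients in
   K[sigma] or divide by t.  A row divided by t in a shift is independent over
   K[sigma], by regularity, of the row module before that shift.  Choosing one such
   row for each shift gives a family in {v : deg_t v <= D}, a free left
   K[sigma]-module of rank m (D + 1), so there are at most m (D + 1) shifts.

   Progress.  The term over position order has order type omega: encoding a row f as
   sum_i f_i(x^m) x^(m-1-i) turns leading monomials into degrees.  A Popov form is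
   reached by cancelling leading monomials in equal positions and moving zero rows
   down, both of which lower sum_i (i + 1) size(row_i). *)

Set Implicit Arguments.
Unset Strict Implicit.
Unset Printing Implicit Defensive.

Import GRing.Theory.
Local Open Scope ring_scope.

Local Notation tofrac := (@FracField.tofrac _).

(** * Coefficients of skew polynomials *)

Lemma skewCM (R : nzRingType) (s : {rmorphism R -> R}) (x y : R) :
  skewC s x * skewC s y = skewC s (x * y).
Proof.
apply/polyP=> i; rewrite [LHS]coef_skewpoly_mul big_ord_recl subn0 big1.
  by rewrite !coefC addr0; case: i => [|i]; rewrite //= mulr0.
by move=> j _; rewrite coefC mul0r.
Qed.

Section SkewRings.
Variables (K : fieldType) (q : K) (q0 : q != 0).
Implicit Types (a b : skew_t q) (p : {poly K}).

Lemma coef_skewD a b i : (a + b)`_i = a`_i + b`_i.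
Proof. exact: coefD. Qed.

Lemma coef_skewM a b i :
  (a * b)`_i = \sum_(j < i.+1) a`_j * iter j (qshift q) b`_(i - j).
Proof. exact: coef_skewpoly_mul. Qed.

Lemma coef_qshift p n k : (iter n (qshift q) p)`_k = q ^+ (n * k) * p`_k.
Proof.
elim: n => [|n IHn]; first by rewrite mul1r.
rewrite iterS mulSn exprD -mulrA -IHn /=; set u := iter _ _ _.
rewrite comp_polyE coef_sum.
have [lt_k | le_k] := ltnP k (size u).
  rewrite (bigD1 (Ordinal lt_k)) //= big1 ?addr0 => [|j neq_jk].
    by rewrite exprZn !coefZ coefXn eqxx mulr1 mulrC.
  rewrite exprZn !coefZ coefXn -[k]/(val (Ordinal lt_k)) val_eqE eq_sym.
  by rewrite (negPf neq_jk) !mulr0.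
rewrite nth_default // mulr0 big1 // => j _; rewrite exprZn !coefZ coefXn.
by rewrite gtn_eqF ?mulr0 //; apply: leq_trans le_k.
Qed.

Fact skew_t_frac_is_zmod_morphism : zmod_morphism (skew_t_frac q0 : skew_t q -> _).
Proof.
move=> a b; apply/polyP=> i; rewrite /skew_t_frac.
by rewrite (coefB (map_poly tofrac a)) !coef_map (coefB a) raddfB.
Qed.

Fact skew_t_frac_is_monoid_morphism :
  monoid_morphism (skew_t_frac q0 : skew_t q -> _).
Proof.
split=> [|a b]; first exact: (map_polyC tofrac 1).
apply/polyP=> i; rewrite [RHS]coef_skewpoly_mul coef_map coef_skewM raddf_sum.
apply: eq_bigr => j _; rewrite !coef_map /= tofracM; congr (_ * _).
by elim: (j : nat) (b`_(i - j)) => //= n IHn u; rewrite -IHn frac_lift_tofrac.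
Qed.

HB.instance Definition _ := GRing.isZmodMorphism.Build (skew_t q) (skew_frac q0)
  (skew_t_frac q0 : skew_t q -> _) skew_t_frac_is_zmod_morphism.
HB.instance Definition _ := GRing.isMonoidMorphism.Build (skew_t q) (skew_frac q0)
  (skew_t_frac q0 : skew_t q -> _) skew_t_frac_is_monoid_morphism.

Lemma skew_t_frac_inj : injective (skew_t_frac q0 : skew_t q -> _).
Proof.
move=> a b /(congr1 (fun c : skew_frac q0 => c`_(_ : nat))) eq_ab.
apply/polyP=> i; apply/eqP; rewrite -tofrac_eq; apply/eqP.
by have := eq_ab i; rewrite /skew_t_frac !coef_map.
Qed.

Lemma coef_skew_constM p a i :
  (skew_const q p * a)`_i = \sum_(j < i.+1) p`_j *: iter j (qshift q) a`_(i - j).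
Proof. by rewrite coef_skewM; apply: eq_bigr => j _; rewrite coef_map mul_polyC. Qed.

Fact skew_const_is_zmod_morphism : zmod_morphism (skew_const q).
Proof.
move=> p u; apply/polyP=> i; rewrite /skew_const.
by rewrite (coefB (map_poly polyC p)) !coef_map coefB raddfB.
Qed.

Fact skew_const_is_monoid_morphism : monoid_morphism (skew_const q).
Proof.
split=> [|p u]; first exact: (map_polyC polyC 1).
apply/polyP=> i; rewrite coef_skew_constM coef_map coefM raddf_sum.
apply: eq_bigr => j _; rewrite coef_map -mul_polyC /= polyCM; congr (_ * _).
by elim: (j : nat) (u`_(i - j)) => //= n IHn c; rewrite -IHn comp_polyC.
Qed.

HB.instance Definition _ := GRing.isZmodMorphism.Build {poly K} (skew_t q)
  (skew_const q) skew_const_is_zmod_morphism.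
HB.instance Definition _ := GRing.isMonoidMorphism.Build {poly K} (skew_t q)
  (skew_const q) skew_const_is_monoid_morphism.

(* The coefficient of t^k when the powers of t are written on the right.  Unlike
   [tcoef k], it is linear for the left action of K[sigma]. *)
Definition rcoef (k : nat) a : {poly K} :=
  \poly_(j < size a) (q ^- (k * j) * (a`_j)`_k).

Lemma coef_rcoef k a j : (rcoef k a)`_j = q ^- (k * j) * (a`_j)`_k.
Proof.
by rewrite coef_poly; case: ltnP => // le_j; rewrite (nth_default _ le_j) coef0 mulr0.
Qed.

Fact rcoef_is_zmod_morphism k : zmod_morphism (rcoef k).
Proof.
move=> a b; apply/polyP=> j.
by rewrite coefB !coef_rcoef (coefB (a : {poly {poly K}})) coefB mulrBr.
Qed.

HB.instance Definition _ k := GRing.isZmodMorphism.Build (skew_t q) {poly K}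
  (rcoef k) (rcoef_is_zmod_morphism k).

(** The j-fold [qshift] multiplies the coefficient of t^k by q^(jk), which cancels against the
    factor q^(-kj) split off from q^(-ki). *)
Lemma rcoef_constM k p a : rcoef k (skew_const q p * a) = p * rcoef k a.
Proof.
apply/polyP=> i; rewrite coef_rcoef coef_skew_constM coef_sum coefM mulr_sumr.
apply: eq_bigr => j _; rewrite coefZ coef_qshift coef_rcoef mulrCA; congr (_ * _).
have le_ji : (j <= i)%N by rewrite -ltnS.
rewrite mulrA; congr (_ * _); rewrite -{1}(subnK le_ji) mulnDr exprD invfM.
by rewrite [(j * k)%N]mulnC mulfVK // expf_neq0.
Qed.

Lemma rcoef0_const p : rcoef 0 (skew_const q p) = p.
Proof.
apply/polyP=> j; rewrite coef_rcoef mul0n expr0 invr1 mul1r.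
by rewrite coef_map coefC.
Qed.

Lemma tcoef0E : tcoef 0 =1 rcoef 0.
Proof.
move=> a; apply/polyP=> j; rewrite coef_rcoef mul0n expr0 invr1 mul1r coef_poly.
by case: ltnP => // le_j; rewrite (nth_default _ le_j) coef0.
Qed.

Definition tdeg_le D a := forall j, (size (a`_j)%R <= D.+1)%N.

Lemma tdeg_le0 D : tdeg_le D 0.
Proof. by move=> j; rewrite (coef0 _ j) size_poly0. Qed.

Lemma tdeg_leD D a b : tdeg_le D a -> tdeg_le D b -> tdeg_le D (a + b).
Proof.
move=> Da Db j; rewrite coef_skewD (leq_trans (size_polyD _ _)) // geq_max.
by rewrite Da Db.
Qed.

Lemma tdeg_le_constM D p a : tdeg_le D a -> tdeg_le D (skew_const q p * a).
Proof.
move=> Da i; rewrite coef_skew_constM; apply/leq_sizeP => k lt_k.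
rewrite coef_sum big1 // => j _; rewrite coefZ coef_qshift.
by rewrite (nth_default _ (leq_trans (Da _) lt_k)) !mulr0.
Qed.

Lemma tdeg_le_exists a : exists D, tdeg_le D a.
Proof.
exists (\max_(j < size a) size (a`_j)%R)%N => j.
have [lt_j | le_j] := ltnP j (size a); last by rewrite (nth_default _ le_j) size_poly0.
exact: leqW (leq_bigmax (Ordinal lt_j)).
Qed.

(** Since q is invertible, the normalising powers of q lose nothing: the first D + 1 coefficients
    determine an element of degree at most D in t. *)
Lemma rcoef_eq0 D a :
  tdeg_le D a -> (forall k : 'I_D.+1, rcoef k a = 0) -> a = 0.
Proof.
move=> Da a0; apply/polyP=> j; rewrite (coef0 _ j); apply/polyP=> k.
rewrite coef0; have [lt_k | le_k] := ltnP k D.+1; last first.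
  by rewrite nth_default // (leq_trans (Da j)).
have /(congr1 (fun u : {poly K} => u`_j)) := a0 (Ordinal lt_k).
rewrite coef_rcoef coef0 /= => /eqP; rewrite mulf_eq0 invr_eq0 expf_eq0.
by rewrite (negPf q0) andbF => /eqP.
Qed.

Definition skew_tX : skew_t q := skewC (qshift q) 'X.

Lemma coef_skewtXM a i : (skew_tX * a)`_i = 'X * a`_i.
Proof.
rewrite coef_skewM big_ord_recl subn0 coefC eqxx big1 ?addr0 // => j _.
by rewrite coefC mul0r.
Qed.

(** As sigma^j t = q^j t sigma^j, every term of a right multiple of t keeps a factor t. *)
Lemma rcoef0_MtX a : rcoef 0 (a * skew_tX) = 0.
Proof.
apply/polyP=> i; rewrite coef_rcoef coef_skewM coef0 coef_sum big1 ?mulr0 //.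
move=> j _; rewrite coef0M coef_qshift coefC; case: eqP; rewrite ?coefX ?coef0.
  by rewrite !mulr0.
by rewrite !mulr0.
Qed.

Lemma tdeg_le_tXM D a : tdeg_le D (skew_tX * a) -> tdeg_le D a.
Proof.
move=> Da j; have [-> | nz] := eqVneq a`_j 0; first by rewrite size_poly0.
have := Da j; rewrite coef_skewtXM mulrC size_mulX // => /ltnW; exact.
Qed.

(** Left quotient by t, coefficient by coefficient; constant terms in t are discarded, so it is
    exact only if they vanish. *)
Definition div_tX a : skew_t q := \poly_(j < size a) drop_poly 1 a`_j.

Lemma div_tXK a : rcoef 0 a = 0 -> skew_tX * div_tX a = a.
Proof.
move=> a0; apply/polyP=> j; rewrite coef_skewtXM coef_poly.
case: ltnP => [_|le_j]; last by rewrite mulr0 nth_default.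
have := congr1 (fun u : {poly K} => u`_j) a0.
rewrite coef_rcoef mul0n expr0 invr1 mul1r coef0 => aj0.
rewrite -[RHS](poly_take_drop 1) mulrC expr1 [X in _ = X + _](_ : _ = 0) ?add0r //.
by apply/polyP=> k; rewrite coef_take_poly coef0; case: k.
Qed.

Lemma skew_t_frac_tX :
  skew_t_frac q0 skew_tX = skewC _ (tofrac 'X) :> skew_frac q0.
Proof. by rewrite /skew_t_frac /skew_tX /skewC map_polyC. Qed.

Lemma t_invK : skew_t_frac q0 skew_tX * t_inv q0 = 1.
Proof. by rewrite skew_t_frac_tX [LHS]skewCM divff // tofrac_eq0 polyX_eq0. Qed.

Lemma t_invKr : t_inv q0 * skew_t_frac q0 skew_tX = 1.
Proof. by rewrite skew_t_frac_tX [LHS]skewCM mulVf // tofrac_eq0 polyX_eq0. Qed.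

End SkewRings.

(** * Leading monomials, Popov forms and division over K[sigma] *)

Section Denominators.
Variable R : idomainType.

Lemma clear_denominators n (v : 'rV[{fraction R}]_n) :
  exists2 d : R, d != 0 & exists w : 'rV[R]_n, map_mx tofrac w = tofrac d *: v.
Proof.
pose den j := \d_(repr (v 0 j)).
exists (\prod_j den j); first by apply/prodf_neq0 => j _; apply: denom_ratioP.
exists (\row_j (\n_(repr (v 0 j)) * \prod_(i | i != j) den i)).
apply/rowP=> j; rewrite !mxE [in RHS](bigD1 j) //=.
set b := \prod_(i | _) _; rewrite {2}[v 0 j]frac_reprE !tofracM.
by rewrite [RHS]mulrCA (mulrAC _ (tofrac b)) divff ?mul1r // tofrac_eq0 denom_ratioP.
Qed.

(** Multiplying a relation over the fraction field by a common denominator gives a relation over R,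
    so ranks can be treated without fractions. *)
Lemma frac_row_free m n (A : 'M[R]_(m, n)) :
  row_free (map_mx tofrac A) <-> (forall v : 'rV_m, v *m A = 0 -> v = 0).
Proof.
have inj0 k (w : 'rV[R]_k) : map_mx tofrac w = 0 -> w = 0.
  move=> w0; apply/rowP=> j; move/rowP/(_ j): w0; rewrite !mxE => /eqP.
  by rewrite tofrac_eq0 => /eqP.
split=> [freeA v vA0 | freeA].
  apply: inj0; apply: (row_free_inj freeA).
  by rewrite mul0mx -map_mxM vA0 map_mx0.
apply: inj_row_free => v vA0; have [d nz_d [w Dw]] := clear_denominators v.
have w0 : w = 0.
  by apply/freeA/inj0; rewrite map_mxM Dw -scalemxAl vA0 scaler0.
apply/eqP; move/eqP: Dw; rewrite w0 map_mx0 eq_sym scaler_eq0 tofrac_eq0.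
by rewrite (negPf nz_d).
Qed.

End Denominators.

Section Monomials.
Variables (K : fieldType) (m : nat).
Implicit Types (f g : 'rV[{poly K}]_m) (u v : monom m).

(* The term over position order on monomials is isomorphic to [nat]: the row f is
   encoded by sum_i f_i(x^m) x^(m-1-i), whose degree is the rank of the leading
   monomial of f. *)
Definition monom_rank u : nat := u.2 * m + rev_ord u.1.

Definition enc f : {poly K} := \sum_(i < m) (f 0 i \Po 'X^m) * 'X^(rev_ord i).

Lemma monom_rank_surj k : (0 < m)%N -> exists u, monom_rank u = k.
Proof.
move=> m_gt0; exists (rev_ord (Ordinal (ltn_pmod k m_gt0)), (k %/ m)%N).
by rewrite /monom_rank rev_ordK /= -divn_eq.
Qed.

Lemma top_leE u v : top_le u v = (monom_rank u <= monom_rank v)%N.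
Proof.
(* The position contributes less than m, so it cannot make up for a smaller exponent. *)
have rank_lt (x y : monom m) : (x.2 < y.2)%N -> (monom_rank x < monom_rank y)%N.
  move=> lt_xy; apply: leq_trans (leq_addr _ _).
  by apply: leq_trans (leq_mul lt_xy (leqnn m)); rewrite mulSnr ltn_add2l ltn_ord.
rewrite /top_le; case: ltngtP => [/rank_lt/ltnW-> // | /rank_lt | eq_uv] /=.
  by rewrite ltnNge => /negbTE.
by rewrite /monom_rank eq_uv leq_add2l /= leq_sub2lE.
Qed.

Lemma monom_rank_inj : injective monom_rank.
Proof.
move=> u v eq_uv; have: top_le u v && top_le v u by rewrite !top_leE eq_uv leqnn.
case: u v {eq_uv} => [i a] [j b]; rewrite /top_le /=.
case: ltngtP => //= -> /= /andP[le_ji le_ij]; congr (_, _).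
by apply/val_inj/eqP; rewrite eqn_leq le_ij.
Qed.

(** The summand for position j only has exponents congruent to [rev_ord j] modulo m, so different
    monomials never share a degree. *)
Lemma coef_enc f u : (enc f)`_(monom_rank u) = (f 0 u.1)`_(u.2).
Proof.
have m_gt0 : (0 < m)%N by apply: leq_trans (ltn_ord u.1).
rewrite coef_sum (bigD1 u.1) //= coefMXn ltnNge leq_addl addnK.
rewrite coef_comp_poly_Xn // dvdn_mull // mulnK // big1 ?addr0 // => j neq_ju.
rewrite coefMXn; case: ltnP => // le_j; rewrite coef_comp_poly_Xn //.
case: ifP => // /dvdnP[b Db]; have Du : monom_rank u = monom_rank (j, b).
  by rewrite -(subnK le_j) Db.
by case/eqP: neq_ju; move/monom_rank_inj: Du => ->.
Qed.

Fact enc_is_zmod_morphism : zmod_morphism enc.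
Proof.
move=> f g; rewrite -sumrB; apply: eq_bigr => i _.
by rewrite !mxE comp_polyB mulrBl.
Qed.

HB.instance Definition _ := GRing.isZmodMorphism.Build 'rV[{poly K}]_m {poly K}
  enc enc_is_zmod_morphism.

Lemma encZ p f : enc (p *: f) = (p \Po 'X^m) * enc f.
Proof.
rewrite /enc mulr_sumr; apply: eq_bigr => i _.
by rewrite mxE comp_polyM mulrA.
Qed.

Lemma enc_eq0 f : (enc f == 0) = (f == 0).
Proof.
apply/eqP/eqP=> [f0 | ->]; last exact: raddf0.
apply/rowP=> i; rewrite mxE; apply/polyP=> a.
by rewrite -(coef_enc f (i, a)) f0 !coef0.
Qed.

Lemma row_nz_gt0 f : f != 0 -> (0 < m)%N.
Proof. by case: (m) f => // f; rewrite thinmx0 eqxx. Qed.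

Lemma in_supportE f u : in_support f u = ((enc f)`_(monom_rank u) != 0).
Proof. by rewrite coef_enc. Qed.

(** Ranks are the degrees in [enc f], so the greatest monomial of the support can be read off the
    size. *)
Lemma is_lead_monomE f u :
  is_lead_monom f u <-> size (enc f) = (monom_rank u).+1.
Proof.
split=> [[fu max_u] | sz_f].
  rewrite in_supportE in fu; apply/eqP; rewrite eqn_leq andbC ltnNge.
  rewrite (contra _ fu) => [/=|le_sz]; last by rewrite nth_default.
  have nz_f : enc f != 0 by apply: contraNneq fu => ->; rewrite coef0.
  have m_gt0 : (0 < m)%N by apply: leq_trans (ltn_ord u.1).
  have [v Dv] := monom_rank_surj (size (enc f)).-1 m_gt0.
  rewrite -(prednK (n := size (enc f))) ?size_poly_gt0 // ltnS -Dv -top_leE.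
  by apply: max_u; rewrite in_supportE Dv -lead_coefE lead_coef_eq0.
have nz_f : enc f != 0 by rewrite -size_poly_eq0 sz_f.
split=> [|v fv].
  by rewrite in_supportE -[monom_rank u]/(_.+1.-1) -sz_f -lead_coefE lead_coef_eq0.
rewrite top_leE -ltnS -sz_f ltnNge; apply: contraL fv => le_sz.
by rewrite in_supportE nth_default ?eqxx.
Qed.

Lemma is_lead_monom_inj f u v : is_lead_monom f u -> is_lead_monom f v -> u = v.
Proof.
by move/is_lead_monomE=> sz_u /is_lead_monomE; rewrite sz_u => -[/monom_rank_inj].
Qed.

Lemma lead_monom_exists f : f != 0 -> exists u, is_lead_monom f u.
Proof.
move=> nz_f; have [u Du] := monom_rank_surj (size (enc f)).-1 (row_nz_gt0 nz_f).
by exists u; apply/is_lead_monomE; rewrite Du prednK // size_poly_gt0 enc_eq0.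
Qed.

Lemma lead_monomZ p f u : p != 0 -> is_lead_monom f u ->
  is_lead_monom (p *: f) (u.1, (size p).-1 + u.2)%N.
Proof.
move=> nz_p /is_lead_monomE sz_f; apply/is_lead_monomE.
have m_gt0 : (0 < m)%N by apply: leq_trans (ltn_ord u.1).
have nz_f : enc f != 0 by rewrite -size_poly_eq0 sz_f.
(* The coefficient of x^(m deg p) in p(x^m) is the leading coefficient of p. *)
have nz_px : p \Po 'X^m != 0.
  apply: contraNneq nz_p => px0; rewrite -lead_coef_eq0 lead_coefE.
  move/(congr1 (fun r : {poly K} => r`_((size p).-1 * m))): px0.
  by rewrite coef_comp_poly_Xn // dvdn_mull // mulnK // coef0 => ->.
rewrite encZ size_mul // sz_f addnS /= -(prednK (n := size (p \Po _))).
  by rewrite size_comp_poly size_polyXn /monom_rank /= mulnDl addnA.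
by rewrite size_poly_gt0.
Qed.

(** Multiplying g by c sigma^(u.2 - v.2) aligns its leading monomial with that of f, and c equalises
    the leading coefficients. *)
Lemma lead_monom_cancel f g u v :
    is_lead_monom f u -> is_lead_monom g v -> mdvd v u ->
  exists p, (size (enc (f - p *: g)) < size (enc f))%N.
Proof.
move=> lead_u lead_v /andP[/eqP eq_uv le_uv].
have /is_lead_monomE sz_f := lead_u; have /is_lead_monomE sz_g := lead_v.
have nz_f : enc f != 0 by rewrite -size_poly_eq0 sz_f.
have nz_g : enc g != 0 by rewrite -size_poly_eq0 sz_g.
pose c := lead_coef (enc f) / lead_coef (enc g).
have nz_c : c != 0 by rewrite mulf_neq0 ?invr_eq0 ?lead_coef_eq0.
pose p := c *: 'X^(u.2 - v.2); exists p.
have nz_p : p != 0 by rewrite scaler_eq0 negb_or nz_c -size_poly_eq0 size_polyXn.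
have := lead_monomZ nz_p lead_v; rewrite size_scale // size_polyXn /= subnK //.
have -> : (v.1, u.2) = u by rewrite eq_uv; case: (u).
move/is_lead_monomE=> sz_pg; rewrite raddfB /= sz_f ltnS.
have lc_pg : lead_coef (enc (p *: g)) = lead_coef (enc f).
  rewrite encZ lead_coefM comp_polyZ comp_Xn_poly -exprM lead_coefZ lead_coefXn.
  by rewrite mulr1 divfK // lead_coef_eq0.
apply/leq_sizeP => k; rewrite leq_eqVlt coefB => /predU1P[<- | lt_k].
  move: lc_pg; rewrite !lead_coefE sz_pg sz_f /= => ->; exact: subrr.
by rewrite !nth_default ?subrr ?sz_f ?sz_pg.
Qed.

End Monomials.

(** * Weak Popov forms and Groebner division *)

Section PopovForms.
Variables (K : fieldType) (m : nat).

(** The weak Popov form. Zero rows have no leading monomial and satisfy the condition vacuously. *)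
Definition distinct_lead_positions r (P : 'M[{poly K}]_(r, m)) : Prop :=
  forall i j u v, i != j ->
    is_lead_monom (row i P) u -> is_lead_monom (row j P) v -> u.1 != v.1.

(** The nonzero multiples [g i] have leading monomials in different positions, so no two coincide
    and the greatest one survives in the sum. *)
Lemma lead_monom_comb r (P : 'M[{poly K}]_(r, m)) (c : 'rV_r) :
    distinct_lead_positions P -> (forall i, row i P != 0) -> c != 0 ->
  exists i u v,
    [/\ is_lead_monom (row i P) v, is_lead_monom (c *m P) u & mdvd v u].
Proof.
move=> distP nzP /rV0Pn[i1 nz_c1].
pose g i := c 0 i *: row i P.
have lead_g i : c 0 i != 0 -> exists u v,
    [/\ is_lead_monom (row i P) v, is_lead_monom (g i) u & mdvd v u].
  move=> nz_c; have [v lead_v] := lead_monom_exists (nzP i).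
  exists (v.1, (size (c 0%R i)).-1 + v.2)%N, v; split=> //.
    exact: lead_monomZ.
  by rewrite /mdvd eqxx leq_addl.
case: (@arg_maxnP _ i1 (fun i => c 0 i != 0) (fun i => size (enc (g i))) nz_c1).
move=> /= i nz_ci max_i.
have [u [v [lead_v lead_u dvd_vu]]] := lead_g i nz_ci.
exists i, u, v; split=> //; apply/is_lead_monomE.
have /is_lead_monomE sz_u := lead_u.
rewrite mulmx_sum_row raddf_sum (bigD1 i) //= size_polyDl //.
rewrite sz_u ltnS; apply: (leq_trans (size_sum _ _ _)); apply/bigmax_leqP=> j neq_ji.
have [-> | nz_cj] := eqVneq (c 0 j) 0; first by rewrite scale0r raddf0 size_poly0.
(* Equal sizes would mean equal leading monomials, hence equal positions. *)
have := max_i j nz_cj; rewrite sz_u leq_eqVlt => /predU1P[eq_ji | //].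
have [u' [v' [lead_v' lead_u' dvd_vu']]] := lead_g j nz_cj.
have /is_lead_monomE := lead_u'; rewrite eq_ji => -[/monom_rank_inj eq_u].
case/andP: dvd_vu; case/andP: dvd_vu'; rewrite -eq_u => /eqP eq_v' _ /eqP eq_v _.
by have := distP j i v' v neq_ji lead_v' lead_v; rewrite eq_v' eq_v eqxx.
Qed.

Lemma distinct_lead_positions_popov r (P : 'M[{poly K}]_(r, m)) :
  distinct_lead_positions P -> (forall i, row i P != 0) -> popov_form P.
Proof.
move=> distP nzP; split=> // [c u lead_u | i j u v neq_ij lead_u lead_v].
  have nz_c : c != 0.
    apply: contraPneq lead_u => ->; rewrite mul0mx => -[].
    by rewrite /in_support mxE coef0 eqxx.
  have [i [u' [v [lead_v lead_u' dvd_vu]]]] := lead_monom_comb distP nzP nz_c.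
  by exists i, v; rewrite (is_lead_monom_inj lead_u lead_u').
by rewrite negb_and (distP i j u v).
Qed.

Lemma distinct_lead_positions_free r (P : 'M[{poly K}]_(r, m)) (c : 'rV_r) :
    distinct_lead_positions P -> (forall i, row i P != 0) ->
  c *m P = 0 -> c = 0.
Proof.
move=> distP nzP cP0; apply/eqP; apply: contraPT cP0 => nz_c cP0.
have [i [u [v [_ [+ _] _]]]] := lead_monom_comb distP nzP nz_c.
by rewrite cP0 /in_support mxE coef0 eqxx.
Qed.

Definition echelon_rows n (N : 'M[{poly K}]_(n, m)) : Prop :=
  forall i j : 'I_n, (i < j)%N -> row i N = 0 -> row j N = 0.

Lemma weak_popov n (N : 'M[{poly K}]_(n, m)) : (0 < m)%N ->
  exists X : 'M_n, [/\ X \in unitmx, distinct_lead_positions (X *m N)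
                     & echelon_rows (X *m N)].
Proof.
move=> m_gt0; pose wt (N : 'M[{poly K}]_(n, m)) :=
  (\sum_(i < n) i.+1 * size (enc (row i N)))%N.
have [k] := ubnP (wt N); elim: k N => // k IHk N; rewrite ltnS => le_wt.
have step (E : 'M_n) : E \in unitmx -> (wt (E *m N) < wt N)%N ->
    exists X : 'M_n, [/\ X \in unitmx, distinct_lead_positions (X *m N)
                       & echelon_rows (X *m N)].
  move=> unitE /leq_trans/(_ le_wt)/IHk[X [unitX distX echX]].
  by exists (X *m E); rewrite -mulmxA unitmx_mul unitX.
have [/existsP[i /existsP[j /and3P[lt_ij /eqP Ni0 nzNj]]] | ech] :=
    boolP [exists i : 'I_n, exists j : 'I_n,
             [&& (i < j)%N, row i N == 0 & row j N != 0]].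
  (* Swapping moves the nonzero row from weight j + 1 to the smaller weight i + 1, and the zero row
     contributes nothing. *)
  apply: (step (tperm_mx i j)); first exact: unitmx_perm.
  have neq_ij : j != i by rewrite -val_eqE gtn_eqF.
  rewrite -xrowE /wt (bigD1 i) // [X in (_ < X)%N](bigD1 i) //.
  rewrite [X in (_ + X < _)%N](bigD1 j) // [X in (_ < _ + X)%N](bigD1 j) //.
  rewrite [X in (X < _)%N]addnA [X in (_ < X)%N]addnA.
  rewrite (eq_bigr (fun l : 'I_n => l.+1 * size (enc (row l N)))%N).
    rewrite ltn_add2r Ni0 raddf0 size_poly0 muln0 add0n.
    rewrite (_ : row i (xrow i j N) = row j N); last first.
      by apply/rowP=> l; rewrite !mxE tpermL.
    rewrite (_ : row j (xrow i j N) = row i N); last first.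
      by apply/rowP=> l; rewrite !mxE tpermR.
    by rewrite Ni0 raddf0 size_poly0 muln0 addn0 ltn_pmul2r ?size_poly_gt0 ?enc_eq0.
  move=> l /andP[neq_li neq_lj]; congr (_ * size (enc _))%N.
  by apply/rowP=> c; rewrite !mxE tpermD // eq_sym.
have [u Du] : exists u : 'I_n -> monom m,
    forall i, row i N != 0 -> is_lead_monom (row i N) (u i).
  apply: (@fin_all_exists _ (fun=> monom m)
            (fun i v => row i N != 0 -> is_lead_monom (row i N) v)) => i.
  have [-> | /lead_monom_exists[v]] := eqVneq (row i N) 0; last by exists v.
  (* A zero row receives an arbitrary monomial, about which [Du] claims nothing. *)
  by have [v _] := monom_rank_surj 0 m_gt0; exists v.
have [/existsP[i /existsP[j /and4P[neq_ij nzNi nzNj dvd_ij]]] | dist] :=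
    boolP [exists i, exists j,
             [&& i != j, row i N != 0, row j N != 0 & mdvd (u i) (u j)]].
  have [p lt_p] := lead_monom_cancel (Du j nzNj) (Du i nzNi) dvd_ij.
  have row_E a l : row l ((1%:M + a *: delta_mx j i) *m N)
      = row l N + (a *+ (l == j)) *: row i N.
    apply/rowP=> c; rewrite mulmxDl mul1mx !mxE; congr (_ + _).
    rewrite (bigD1 i) //= big1 ?addr0 => [|l' neq_l']; rewrite !mxE.
      by rewrite eqxx andbT mulr_natr.
    by rewrite (negPf neq_l') andbF mulr0 mul0r.
  have E_E a b : (1%:M + a *: delta_mx j i) *m (1%:M + b *: delta_mx j i)
      = 1%:M + (a + b) *: delta_mx j i :> 'M[{poly K}]_n.
    rewrite mulmxDl mul1mx mulmxDr mulmx1 -scalemxAl -scalemxAr.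
    by rewrite mul_delta_mx_0 // !scaler0 addr0 -addrA -scalerDl (addrC b).
  (* This elementary matrix subtracts p times row i from row j, which cancels the leading term of
     row j. *)
  apply: (step (1%:M + (- p) *: delta_mx j i)).
    apply: (proj1 (mulmx1_unit (_ : _ *m (1%:M + p *: delta_mx j i) = 1%:M))).
    by rewrite E_E addNr scale0r addr0.
  rewrite /wt (bigD1 j) // [X in (_ < X)%N](bigD1 j) // -addSn leq_add //.
    by rewrite row_E eqxx mulr1n scaleNr ltn_pmul2l.
  by apply: leq_sum => l neq_lj; rewrite row_E (negPf neq_lj) scale0r addr0.
exists 1%:M; rewrite mul1mx unitmx1; split=> //.
  move=> i j v w neq_ij lead_v lead_w; apply: contra dist => eq_vw.
  have nz_lead l x : is_lead_monom (row l N) x -> row l N != 0.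
    case=> + _; apply: contraTneq => ->; by rewrite /in_support mxE coef0 eqxx.
  have [nzNi nzNj] := (nz_lead i v lead_v, nz_lead j w lead_w).
  have eq_u := is_lead_monom_inj (Du i nzNi) lead_v.
  have eq_u' := is_lead_monom_inj (Du j nzNj) lead_w.
  (* Of two monomials in the same position, the one with the smaller exponent divides the other, so
     a further cancellation would be possible. *)
  have [le_vw | /ltnW le_wv] := leqP v.2 w.2.
    apply/existsP; exists i; apply/existsP; exists j.
    by rewrite neq_ij nzNi nzNj eq_u eq_u' /mdvd eq_vw.
  apply/existsP; exists j; apply/existsP; exists i.
  by rewrite eq_sym neq_ij nzNi nzNj eq_u eq_u' /mdvd eq_sym eq_vw.
move=> i j lt_ij Ni0; apply/eqP; apply: contraNT ech => nzNj.
by apply/existsP; exists i; apply/existsP; exists j; rewrite lt_ij Ni0 eqxx.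
Qed.

Lemma poly_rank_unitMl n (X : 'M[{poly K}]_n) (M : 'M[{poly K}]_(n, m)) :
  X \in unitmx -> poly_rank (X *m M) = poly_rank M.
Proof.
move=> unitX; rewrite /poly_rank map_mxM eqmxMfull //.
by rewrite row_full_unit unitmxE det_map_mx rmorph_unit -?unitmxE.
Qed.

(** Take r least such that all rows of the reduced matrix from r on vanish. The echelon shape makes
    the first r rows nonzero, and their independence identifies r with the rank. *)
Lemma popov_exists n (M : 'M[{poly K}]_(n, m)) : (0 < m)%N ->
  exists s (e : (poly_rank M + s)%N = n) (P : 'M_(poly_rank M, m)) (X : 'M_n),
    [/\ popov_form P, X \in unitmx & X *m M = stack_mx e P 0].
Proof.
move=> /(weak_popov M)[X [unitX distN echN]].
pose zero_from r := [forall i : 'I_n, (r <= i)%N ==> (row i (X *m M) == 0)].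
have ex_r : exists r, zero_from r.
  by exists n; apply/forallP=> i; rewrite leqNgt ltn_ord.
case: (ex_minnP ex_r) => r /forallP zero_r min_r.
have le_rn : (r <= n)%N.
  by apply: min_r; apply/forallP=> i; rewrite leqNgt ltn_ord.
have nz_r (i : 'I_n) : (i < r)%N -> row i (X *m M) != 0.
  move=> lt_ir; apply: contraL lt_ir => /eqP Ni0; rewrite -leqNgt; apply: min_r.
  apply/forallP=> j; apply/implyP; rewrite leq_eqVlt => /predU1P[/val_inj <- |].
    exact/eqP.
  by move/echN/(_ Ni0)/eqP.
have rankM := poly_rank_unitMl M unitX.
have [N Dn] : exists N, X *m M = N by exists (X *m M).
rewrite Dn in distN rankM zero_r nz_r.
suff: exists (P : 'M_(r, m)), [/\ popov_form P, poly_rank N = r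
         & N = stack_mx (subnKC le_rn) P 0].
  case=> P [popP rankN DN]; rewrite -rankM rankN.
  by exists (n - r)%N, (subnKC le_rn), P, X; rewrite Dn.
move: (n - r)%N (subnKC le_rn) => s e.
move=> {X unitX M Dn rankM echN le_rn min_r zero_from ex_r}.
(* Eliminating the equation turns n into r + s, so that the casts become trivial. *)
case: n / e in N distN zero_r nz_r *.
have nzP i : row i (usubmx N) != 0.
  have := nz_r (lshift s i) (ltn_ord i); rewrite (_ : row _ N = row i (usubmx N)) //.
  by apply/rowP=> j; rewrite !mxE.
have distP : distinct_lead_positions (usubmx N).
  have eq_row i : row i (usubmx N) = row (lshift s i) N by apply/rowP=> j; rewrite !mxE.
  by move=> i j u v neq_ij; rewrite !eq_row; apply: distN.
exists (usubmx N).
have DN : N = col_mx (usubmx N) 0.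
  rewrite -[LHS]vsubmxK; congr col_mx; apply/row_matrixP=> i.
  have := zero_r (rshift r i); rewrite leq_addr => /eqP/rowP Ni0.
  by apply/rowP=> j; have:= Ni0 j; rewrite !mxE.
split; rewrite /stack_mx ?castmx_id //; first exact: distinct_lead_positions_popov.
have /eqP rankP : row_free (map_mx tofrac (usubmx N)).
  by apply/frac_row_free => c; apply: distinct_lead_positions_free.
by rewrite /poly_rank DN map_col_mx map_mx0 rank_col_mx0.
Qed.

(** Induction on the size of [enc y]: a leading term divisible by a leading monomial of P is
    cancelled, any other leading term is moved to the remainder. *)
Lemma groebner_division r (P : 'M[{poly K}]_(r, m)) (y : 'rV[{poly K}]_m) :
    (forall i, row i P != 0) ->
  exists (x : 'rV_r) (z : 'rV_m), y = x *m P + z /\ ~ reducible P z.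
Proof.
move=> nzP; have [u Du] : exists u : 'I_r -> monom m,
    forall i, is_lead_monom (row i P) (u i).
  apply: (@fin_all_exists _ (fun=> monom m)
            (fun i v => is_lead_monom (row i P) v)) => i.
  exact: lead_monom_exists.
have redE z : reducible P z -> exists i w, in_support z w /\ mdvd (u i) w.
  case=> i [w [v [lead_v zw dvd_vw]]]; exists i, w; split=> //.
  by rewrite (is_lead_monom_inj (Du i) lead_v).
have [k] := ubnP (size (enc y)); elim: k y => // k IHk y; rewrite ltnS => le_yk.
have [-> | nz_y] := eqVneq y 0.
  exists 0, 0; rewrite mul0mx addr0; split=> //.
  by case/redE=> i [w []]; rewrite /in_support mxE coef0 eqxx.
have [w lead_w] := lead_monom_exists nz_y.
have [/existsP[i dvd_iw] | irr_w] := boolP [exists i, mdvd (u i) w].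
  have [p lt_p] := lead_monom_cancel lead_w (Du i) dvd_iw.
  have [x [z [Dz irr_z]]] := IHk _ (leq_trans lt_p le_yk).
  exists (x + p *: delta_mx 0 i), z; split=> //.
  rewrite mulmxDl addrAC -Dz -scalemxAl -rowE subrK //.
pose c := (y 0 w.1)`_(w.2).
pose f : 'rV[{poly K}]_m := (c *: 'X^(w.2)) *: delta_mx 0 w.1.
have f_coef v : (f 0 v.1)`_(v.2) = c *+ (v == w).
  rewrite !mxE eqxx /= -scalerAl coefZ.
  case: eqP => [eq1|neq1]; last first.
    by rewrite mulr0 coef0 mulr0; case: eqP neq1 => // ->.
  rewrite mulr1 coefXn; case: v w eq1 {lead_w irr_w f} @c => [i a] [j b] /= ->.
  by rewrite xpair_eqE eqxx /= mulr_natr.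
have /is_lead_monomE sz_y := lead_w.
have lt_p : (size (enc (y - f)) < size (enc y))%N.
  rewrite sz_y ltnS; apply/leq_sizeP => l le_l.
  have m_gt0 := row_nz_gt0 nz_y; have [v Dv] := monom_rank_surj l m_gt0.
  rewrite -Dv coef_enc 2!mxE coefD coefN f_coef; have [-> | neq_vw] := eqVneq v w.
    by rewrite mulr1n subrr.
  rewrite subr0 -coef_enc nth_default // sz_y Dv ltn_neqAle le_l andbT -Dv.
  by rewrite (inj_eq (@monom_rank_inj m)) eq_sym.
have [x [z [Dz irr_z]]] := IHk _ (leq_trans lt_p le_yk).
exists x, (z + f); split; first by rewrite addrA -Dz subrK.
(* Only w can be new in the support of z + f, and no leading monomial of P divides w. *)
case/redE=> i [v []]; rewrite /in_support mxE coefD f_coef.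
have [-> _ dvd_iw | _ ] := eqVneq v w.
  by case/existsP: irr_w; exists i.
by rewrite addr0 => zv dvd_iv; case: irr_z; exists i, v, (u i).
Qed.

End PopovForms.

(** * The procedure *)

Section GeneralLinear.
Variables (R S : nzRingType) (m : nat).

Lemma GL_mul (U V : 'M[R]_m) : GL U -> GL V -> GL (U *m V).
Proof.
move=> [U' [UU' U'U]] [V' [VV' V'V]]; exists (V' *m U').
by rewrite -!mulmxA (mulmxA V) VV' mul1mx UU' (mulmxA U') U'U mul1mx V'V.
Qed.

Lemma GL_map (f : {rmorphism R -> S}) (U : 'M[R]_m) : GL U -> GL (map_mx f U).
Proof.
by case=> V [UV VU]; exists (map_mx f V); rewrite -!map_mxM UV VU map_mx1.
Qed.

Lemma GL_row_inj n (U : 'M[R]_m) (v : 'M_(n, m)) : GL U -> v *m U = 0 -> v = 0.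
Proof. by case=> V [UV _] vU0; rewrite -[v]mulmx1 -UV mulmxA vU0 mul0mx. Qed.

End GeneralLinear.

Section Stacking.
Variables (R : Type) (r m n : nat).

Lemma stack_mxE s (e : (r + s)%N = m) (P : 'M[R]_(r, n)) (N : 'M_(s, n)) i j :
  stack_mx e P N (cast_ord e (lshift s i)) j = P i j.
Proof. by rewrite castmxE cast_ordK col_mxEu cast_ord_id. Qed.

Lemma stack_mxEd s (e : (r + s)%N = m) (P : 'M[R]_(r, n)) (N : 'M_(s, n)) i j :
  stack_mx e P N (cast_ord e (rshift r i)) j = N i j.
Proof. by rewrite castmxE cast_ordK col_mxEd cast_ord_id. Qed.

(** Steps and invariants each bring their own splitting of m, hence the two sizes s and s'. Both
    index the same upper rows. *)
Lemma stack_mx_inj s s' (e : (r + s)%N = m) (e' : (r + s')%N = m)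
    (P P' : 'M[R]_(r, n)) (N : 'M_(s, n)) (N' : 'M_(s', n)) :
  stack_mx e P N = stack_mx e' P' N' -> P = P'.
Proof.
move=> eq_st; apply/matrixP=> i j; rewrite -(stack_mxE e P N) eq_st.
rewrite (_ : cast_ord e _ = cast_ord e' (lshift s' i)) ?stack_mxE //.
exact: val_inj.
Qed.

Lemma stack_mx_split s (e : (r + s)%N = m) (M : 'M[R]_(m, n)) :
  exists P N, M = stack_mx e P N.
Proof.
case: m / e M => M; exists (usubmx M), (dsubmx M).
by rewrite /stack_mx castmx_id vsubmxK.
Qed.

End Stacking.

Section Matrices.
Variables (K : fieldType) (q : K) (q0 : q != 0) (m : nat).
Local Notation Kts := (skew_t q).
Local Notation frac := (skew_t_frac q0).
Local Notation const := (skew_const q).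
Implicit Types A B : 'M[Kts]_m.

Lemma t_trailingE A i j : t_trailing A i j = rcoef 0 (A i j).
Proof. by rewrite mxE tcoef0E. Qed.

Lemma t_trailing_const (X : 'M[{poly K}]_m) A :
  t_trailing (map_mx const X *m A) = X *m t_trailing A.
Proof.
apply/matrixP=> i j; rewrite t_trailingE !mxE raddf_sum; apply: eq_bigr => k _.
by rewrite [map_mx const X i k]mxE /= (rcoef_constM q0) t_trailingE.
Qed.

Lemma equivalent_mx_refl A : equivalent_mx q0 A A.
Proof.
by exists 1%:M; split; [exists 1%:M; rewrite mul1mx | rewrite mul1mx].
Qed.

Lemma equivalent_mx_trans A B C :
  equivalent_mx q0 A B -> equivalent_mx q0 B C -> equivalent_mx q0 A C.
Proof.
move=> [U [GU DB]] [V [GV DC]]; exists (V *m U); split; first exact: GL_mul.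
by rewrite -mulmxA -DB.
Qed.

Lemma equivalent_const (X : 'M[{poly K}]_m) A :
  X \in unitmx -> equivalent_mx q0 A (map_mx const X *m A).
Proof.
move=> unitX; exists (map_mx frac (map_mx const X)).
split; last by rewrite map_mxM.
apply/GL_map/GL_map; exists (invmx X).
by rewrite mulmxV ?mulVmx.
Qed.

Lemma equivalent_regular A B :
  equivalent_mx q0 A B -> regular_mx q0 A -> regular_mx q0 B.
Proof.
move=> [U [GU DB]] regA v; rewrite DB mulmxA => /regA; exact: GL_row_inj.
Qed.

(** The matrix Q of the procedure kept over K[sigma], so that the facts about multipliers with
    constant coefficients apply to it. *)
Definition reduction_const r s (e : (r + s)%N = m) (X : 'M[{poly K}]_(s, r)) :
  'M[{poly K}]_m := square_block_mx e 1%:M 0 (- X) 1%:M.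

Lemma reduction_mxE r s (e : (r + s)%N = m) (X : 'M[{poly K}]_(s, r)) :
  reduction_mx q e X = map_mx const (reduction_const e X).
Proof.
rewrite /reduction_mx /reduction_const /square_block_mx; case: m / e.
by rewrite !castmx_id map_block_mx !map_mx1 map_mx0 map_mxN.
Qed.

Lemma reduction_const_unit r s (e : (r + s)%N = m) X :
  @reduction_const r s e X \in unitmx.
Proof.
rewrite /reduction_const /square_block_mx; case: m / e.
by rewrite castmx_id unitmxE det_lblock !det1 mulr1 unitr1.
Qed.

Lemma reduction_const_stack r s n (e : (r + s)%N = m) (X : 'M[{poly K}]_(s, r))
    (P : 'M_(r, n)) (Y : 'M_(s, n)) :
  reduction_const e X *m stack_mx e P (X *m P + Y) = stack_mx e P Y.
Proof.
rewrite /reduction_const /square_block_mx /stack_mx; case: m / e.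
rewrite !castmx_id mul_block_col !mul1mx mul0mx addr0.
by rewrite mulNmx addKr.
Qed.

(** The equation B = T A in the form A = T^-1 B, which avoids negative powers of t and stays inside
    K[t, sigma]. *)
Definition t_shift_rel (r : nat) A B :=
  forall i j, A i j = (if (i < r)%N then 1 else skew_tX q) * B i j.

Lemma shift_mulE r s n (e : (r + s)%N = m) (M : 'M[skew_frac q0]_(m, n)) i j :
  (shift_mx q0 e *m M) i j = (if (i < r)%N then 1 else t_inv q0) * M i j.
Proof.
rewrite /shift_mx /square_block_mx; case: m / e M i => M i.
rewrite castmx_id -{1}[M]vsubmxK mul_block_col mul1mx !mul0mx addr0 add0r.
rewrite mul_scalar_mx -[i]splitK; case: split => k /=.
  by rewrite col_mxEu mxE ltn_ord mul1r.
by rewrite col_mxEd !mxE ltnNge leq_addr.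
Qed.

Lemma shift_mxP r s (e : (r + s)%N = m) A B :
  map_mx frac B = shift_mx q0 e *m map_mx frac A <-> t_shift_rel r A B.
Proof.
split=> [/matrixP DB i j | DA].
  apply: (@skew_t_frac_inj _ _ q0); rewrite rmorphM /=.
  have := DB i j; rewrite shift_mulE !mxE => ->; case: ifP => _.
    by rewrite rmorph1 !mul1r.
  by rewrite mulrA t_invK mul1r.
apply/matrixP=> i j; rewrite shift_mulE !mxE DA; case: ifP => _.
  by rewrite !mul1r.
by rewrite rmorphM mulrA t_invKr mul1r.
Qed.

Lemma shift_mx_GL r s (e : (r + s)%N = m) : GL (shift_mx q0 e).
Proof.
exists (square_block_mx e 1%:M 0 0 (frac (skew_tX q))%:M).
rewrite /shift_mx /square_block_mx; case: m / e; rewrite !castmx_id.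
have scal_block (x y : skew_frac q0) : x * y = 1 ->
    block_mx 1%:M 0 0 x%:M *m block_mx 1%:M 0 0 y%:M = 1%:M :> 'M_(r + s).
  move=> xy1; rewrite mulmx_block mulmx1 mul1mx mulmx0 !mul0mx mulmx0 !addr0 add0r.
  by rewrite -scalar_mxM xy1 -scalar_mx_block.
by split; apply: scal_block; [apply: t_invKr | apply: t_invK].
Qed.

(** The zero block says that the rows from r on have no part free of t, so they are left multiples
    of t. *)
Lemma shift_exists r s (e : (r + s)%N = m) A P :
  t_trailing A = stack_mx e P 0 -> exists B, t_shift_rel r A B.
Proof.
move=> DA; exists (\matrix_(i, j) if (i < r)%N then A i j else div_tX (A i j)).
move=> i j; rewrite mxE; case: ltnP => le_ri; rewrite ?mul1r // div_tXK //.
rewrite -t_trailingE DA.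
have lt_i : (i - r < s)%N by rewrite ltn_subLR // e.
rewrite (_ : i = cast_ord e (rshift r (Ordinal lt_i))) ?stack_mxEd ?mxE //.
by apply: val_inj; rewrite /= subnKC.
Qed.

(** T fixes the first r rows, so their trailing part survives. *)
Lemma shift_trailing r s s' (e : (r + s)%N = m) (e' : (r + s')%N = m) A B P N :
    t_shift_rel r A B -> t_trailing A = stack_mx e P N ->
  exists N', t_trailing B = stack_mx e' P N'.
Proof.
move=> DA trA; have [P1 [N1 trA1]] := stack_mx_split e' (t_trailing A).
have [P2 [N2 trB]] := stack_mx_split e' (t_trailing B).
exists N2; rewrite trB; congr stack_mx; rewrite trA in trA1.
rewrite (stack_mx_inj trA1); apply/matrixP=> i j.
rewrite -(stack_mxE e' P2 N2) -(stack_mxE e' P1 N1) -trB -trA1 -trA !t_trailingE.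
by rewrite DA /= ltn_ord mul1r.
Qed.

(** * Degree in t and families independent over K[sigma] *)

Definition tdeg_mx_le D n (M : 'M[Kts]_(n, m)) := forall i j, tdeg_le D (M i j).

Lemma tdeg_sum_const D n (p : 'I_n -> {poly K}) (a : 'I_n -> Kts) :
  (forall i, tdeg_le D (a i)) -> tdeg_le D (\sum_i const (p i) * a i).
Proof.
move=> Da; apply: (big_ind (tdeg_le D)); first exact: tdeg_le0.
  exact: tdeg_leD.
by move=> i _; apply: tdeg_le_constM.
Qed.

Lemma tdeg_mx_const D (X : 'M[{poly K}]_m) A :
  tdeg_mx_le D A -> tdeg_mx_le D (map_mx const X *m A).
Proof.
move=> DA i j; rewrite mxE.
under eq_bigr do rewrite mxE.
exact: tdeg_sum_const.
Qed.

Lemma tdeg_mx_shift D r A B :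
  t_shift_rel r A B -> tdeg_mx_le D A -> tdeg_mx_le D B.
Proof.
move=> DA dA i j; have := dA i j; rewrite DA; case: ifP => _.
  by rewrite mul1r.
exact: tdeg_le_tXM.
Qed.

Lemma tdeg_mx_exists A : exists D, tdeg_mx_le D A.
Proof.
have [d dA] : exists d : 'I_m * 'I_m -> nat, forall ij,
    tdeg_le (d ij) (A ij.1 ij.2).
  apply: (@fin_all_exists _ (fun=> nat) (fun ij D => tdeg_le D (A ij.1 ij.2))) => ij.
  exact: tdeg_le_exists.
exists (\max_ij d ij)%N => i j k; apply: leq_trans (dA (i, j) k) _.
by rewrite ltnS leq_bigmax.
Qed.

(* n counts the shifts done so far: each one adds a vector to the family. *)
Definition independent_family D n A := exists W : 'M[Kts]_(n, m),
  [/\ exists L : 'M[Kts]_(n, m), W = L *m A, tdeg_mx_le D W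
    & forall p : 'rV[{poly K}]_n, map_mx const p *m W = 0 -> p = 0].

Lemma independent_family0 D A : independent_family D 0 A.
Proof.
exists 0; split=> [|i j|p _]; first by exists 0; rewrite mul0mx.
  by case: i.
exact: thinmx0.
Qed.

(** An invertible multiplier leaves the row module unchanged, so the same family serves. *)
Lemma independent_family_const D n (X : 'M[{poly K}]_m) A : X \in unitmx ->
  independent_family D n A -> independent_family D n (map_mx const X *m A).
Proof.
move=> unitX [W [[L DW] dW freeW]]; exists W; split=> //.
exists (L *m map_mx const (invmx X)).
by rewrite -mulmxA (mulmxA _ _ A) -map_mxM mulVmx // map_mx1 mul1mx.
Qed.

(* The row added to the family is t^-1 a with a a row of A.  A relation
   p t^-1 a \in K[t, sigma]^m A with p in K[sigma] would give p \in K[t, sigma] t by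
   regularity of A, hence p = 0. *)
Lemma independent_family_shift D n r A B : (r < m)%N ->
    regular_mx q0 A -> tdeg_mx_le D B -> t_shift_rel r A B ->
  independent_family D n A -> independent_family D (1 + n) B.
Proof.
move=> lt_rm regA dB DA [W [[L DW] dW freeW]].
pose i0 := Ordinal lt_rm.
exists (col_mx (row i0 B) W); split.
(* Each row of A from r on is t times that of B, so the coefficients in [L] absorb t on the
   right. *)
- exists (col_mx (delta_mx 0 i0)
    (\matrix_(i, k) (L i k * (if (k < r)%N then 1 else skew_tX q)))).
  rewrite mul_col_mx -rowE DW; congr col_mx; apply/matrixP=> i j; rewrite !mxE.
  by apply: eq_bigr => k _; rewrite mxE DA mulrA.
- move=> i j; rewrite mxE; case: split => k; last exact: dW.
  by rewrite mxE.
move=> p; rewrite -[p]hsubmxK; move: (lsubmx p) (rsubmx p) => p0 p1 {p}.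
rewrite (map_row_mx _ p0) mul_row_col => comb0.
have p00 : p0 0 0 = 0.
  (* The relation [comb0] is rewritten as a relation over K(t)[sigma] between the rows of A, where
     regularity applies. *)
  have: (map_mx frac (map_mx const p0) *m (t_inv q0 *: delta_mx 0 i0)
         + map_mx frac (map_mx const p1 *m L)) *m map_mx frac A = 0.
    have row_B : t_inv q0 *: row i0 (map_mx frac A) = map_mx frac (row i0 B).
      apply/rowP=> j; rewrite !mxE DA ltnn rmorphM mulrA t_invKr.
      exact: mul1r.
    rewrite mulmxDl -[X in X + _]mulmxA -scalemxAl -rowE row_B.
    rewrite -[X in X + _]map_mxM -[X in _ + X]map_mxM -[X in _ + map_mx _ X]mulmxA.
    by rewrite -DW -map_mxD comb0 map_mx0.
  move/regA/rowP/(_ i0).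
  rewrite mxE [X in X + _]mxE (bigD1 ord0) //= big1 ?addr0 => [|k]; last first.
    by rewrite ord1.
  rewrite !mxE !eqxx mulr1 => comb1.
  set x := \sum_j _ in comb1.
  (* Multiplying the entry at [i0] on the right by t removes t^-1 and returns the identity to
     K[t, sigma]. *)
  have {comb1}: frac (const (p0 0 0) + x * skew_tX q) = frac 0.
    by rewrite rmorph0 rmorphD rmorphM /= -(mulr1 (frac _)) -(t_invKr q0) mulrA
      -mulrDl comb1 mul0r.
  move/skew_t_frac_inj/(congr1 (rcoef 0)).
  by rewrite !raddf0 raddfD /= rcoef0_MtX addr0 rcoef0_const.
have p0_0 : p0 = 0 by apply/rowP=> j; rewrite ord1 p00 mxE.
rewrite p0_0 (freeW p1) ?row_mx0 //.
by move: comb0; rewrite p0_0 map_mx0 mul0mx add0r.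
Qed.

(** Row i of [M] lists the D + 1 right-hand t-coefficients of the m entries of row i of [W]. This
    map is linear over K[sigma] and injective in degree at most D, so [M] has independent rows and
    its rank n is at most its number of columns. *)
Lemma independent_family_bound D n A :
  independent_family D n A -> (n <= D.+1 * m)%N.
Proof.
move=> [W [_ dW freeW]].
pose M : 'M[{poly K}]_(n, D.+1 * m) :=
  \matrix_(i < n) mxvec (\matrix_(k < D.+1, j < m) rcoef k (W i j)).
have /eqP <- : row_free (map_mx tofrac M).
  apply: (proj2 (frac_row_free M)) => p pM0; apply: freeW.
  apply/matrixP=> i j; rewrite ord1 [RHS]mxE mxE.
  under eq_bigr do rewrite mxE.
  apply: (rcoef_eq0 q0 (D := D)) => [|k]; first exact: tdeg_sum_const.
  rewrite raddf_sum; move/rowP/(_ (mxvec_index k j)): pM0; rewrite !mxE => sum0.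
  rewrite -[RHS]sum0; apply: eq_bigr => l _.
  by rewrite /= (rcoef_constM q0) [M _ _]mxE mxvecE mxE.
exact: rank_leq_col.
Qed.

End Matrices.

(** * Termination, invariants and progress of the runs *)

Section Procedure.
Variables (K : fieldType) (q : K) (q0 : q != 0) (m : nat).
Local Notation const := (skew_const q).
Implicit Types (A B : 'M[skew_t q]_m) (c : config q m).

Definition config_mx c :=
  match c with
  | Test_trailing A | Shift_rows _ A | Reduce_rows _ A | Return A => A
  end.

Lemma t_trailing_reduction r s (e : (r + s)%N = m) (X : 'M[{poly K}]_(s, r)) A
    (B0 : 'M_(r, m)) (Y : 'M_(s, m)) :
    t_trailing A = stack_mx e B0 (X *m B0 + Y) ->
  t_trailing (reduction_mx q e X *m A) = stack_mx e B0 Y.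
Proof.
by move=> trA; rewrite reduction_mxE (t_trailing_const q0) trA reduction_const_stack.
Qed.

Lemma poly_rank_singular (M : 'M[{poly K}]_m) : \det M = 0 -> (poly_rank M < m)%N.
Proof.
move=> detM0; rewrite ltn_neqAle rank_leq_row andbT -/(row_free _) row_free_unit.
by rewrite unitmxE det_map_mx detM0 rmorph0 unitr0.
Qed.

(** The termination invariant. The bound r < m ensures that the next shift divides at least one row
    by t. *)
Definition bounded_config D n c : Prop :=
  [/\ regular_mx q0 (config_mx c), tdeg_mx_le D (config_mx c),
      independent_family D n (config_mx c)
    & match c with Shift_rows r _ | Reduce_rows r _ => (r < m)%N | _ => True end].

(** Serves the Popov step and the reduction step alike: both multiply by an invertible matrix over
    K[sigma]. *)
Lemma bounded_config_const D n (X : 'M[{poly K}]_m) c c' :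
    X \in unitmx -> config_mx c' = map_mx const X *m config_mx c ->
    match c' with Shift_rows r _ | Reduce_rows r _ => (r < m)%N | _ => True end ->
  bounded_config D n c -> bounded_config D n c'.
Proof.
move=> unitX Dc' rc' [regc dc indc _]; split; rewrite ?Dc'.
- by apply: equivalent_regular regc; apply: equivalent_const.
- exact: tdeg_mx_const.
- exact: independent_family_const.
exact: rc'.
Qed.

(** Induction on (D + 1) m - n, which each shift lowers. Without a shift a run is short: a reduction
    leads to a shift or a test, and a test to a return or a shift. *)
Lemma bounded_config_terminates D n c : bounded_config D n c -> terminates q0 c.
Proof.
have [k] := ubnP (D.+1 * m - n).
elim: k n c => [|k IHk] n c; [by case/negP; rewrite ltn0 | rewrite ltnS => le_k].
have acc_shift r A : bounded_config D n (Shift_rows r A) ->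
    terminates q0 (Shift_rows r A).
  move=> [/= regA dA indA lt_rm]; constructor=> c' st; inversion st; subst.
  have DA : t_shift_rel r A A' by apply/(shift_mxP q0 e).
  have dA' := tdeg_mx_shift DA dA.
  have indA' := independent_family_shift lt_rm regA dA' DA indA.
  apply: (IHk n.+1); last first.
    split; [ | exact: dA' | exact: indA' | exact: lt_rm].
    apply: equivalent_regular regA.
    by exists (shift_mx q0 e); split; first exact: shift_mx_GL.
  (* Applied to the enlarged family, the bound gives n < (D + 1) m, so the truncated subtraction
     really decreases. *)
  have := independent_family_bound q0 indA'.
  move=> lt_n; rewrite subnS; apply: leq_trans le_k.
  by rewrite prednK // subn_gt0.
have acc_test A : bounded_config D n (Test_trailing A) ->
    terminates q0 (Test_trailing A).
  move=> boundA; constructor=> c' st; inversion st; subst.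
    by constructor=> c' st'; inversion st'.
  apply: acc_shift; apply: bounded_config_const boundA; [eassumption | reflexivity |].
  exact: poly_rank_singular.
case: c => [A | r A | r A | A] boundA; [exact: acc_test | exact: acc_shift | | ].
  constructor=> c' st; inversion st; subst.
  have lt_rm : (r < m)%N by case: boundA.
  case: ifP => _; [apply: acc_shift | apply: acc_test];
    by apply: (bounded_config_const (reduction_const_unit e X)) boundA;
      rewrite //= reduction_mxE.
by constructor=> c' st; inversion st.
Qed.

(** Besides equivalence, this stores what the next step needs: a zero lower block before a shift, a
    Popov block to divide by before a reduction. *)
Definition trace_inv A0 c : Prop :=
  equivalent_mx q0 A0 (config_mx c) /\
  match c with
  | Test_trailing _ => True
  | Shift_rows r A => exists s (e : (r + s)%N = m) (P : 'M_(r, m)),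
      popov_form P /\ t_trailing A = stack_mx e P 0
  | Reduce_rows r A => exists s (e : (r + s)%N = m) (P : 'M_(r, m)) C,
      popov_form P /\ t_trailing A = stack_mx e P C
  | Return A => \det (t_trailing A) != 0
  end.

Lemma trace_inv_step A0 c c' : step q0 c c' -> trace_inv A0 c -> trace_inv A0 c'.
Proof.
case=> {c c'} [A detA | A r s e P X det0 Dr popP unitX trA | A A' r s e DA' |
               A r s e B0 C0 Y X trA DC irrY] [/= eqA invA].
- by split.
- split; first exact: equivalent_mx_trans eqA (equivalent_const _ _ unitX).
  by exists s, e, P; rewrite (t_trailing_const q0).
- split.
    apply: equivalent_mx_trans eqA _.
    by exists (shift_mx q0 e); split; first exact: shift_mx_GL.
  have [s' [e' [P [popP trA]]]] := invA.
  have [C trA'] := shift_trailing e (proj1 (shift_mxP _ _ _ _) DA') trA.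
  by exists s, e, P, C.
have eqA' : equivalent_mx q0 A0 (reduction_mx q e X *m A).
  apply: equivalent_mx_trans eqA _; rewrite reduction_mxE.
  exact/equivalent_const/reduction_const_unit.
have [s' [e' [P [C [popP trA']]]]] := invA.
rewrite trA in trA'; rewrite -(stack_mx_inj trA') in popP.
rewrite DC in trA; have := t_trailing_reduction trA.
(* If Y = 0, the lower block is zero again, as the next shift requires; a test asks for nothing. *)
by case: eqP => [-> trQ | _ _]; split=> //; exists s, e, B0.
Qed.

Lemma trace_inv_reachable A0 c c' :
  reachable q0 c c' -> trace_inv A0 c -> trace_inv A0 c'.
Proof.
elim=> {c c'} [c c' | // | c c' c'' _ IH1 _ IH2]; first exact: trace_inv_step.
by move/IH1.
Qed.

Lemma trace_inv_progress A0 c :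
  trace_inv A0 c -> (exists B, c = Return B) \/ (exists c', step q0 c c').
Proof.
case: c => [A | r A | r A | A] [_ /= invA]; last by left; exists A.
- right; have [det0 | nz_det] := eqVneq (\det (t_trailing A)) 0; last first.
    by exists (Return A); constructor.
  have m_gt0 : (0 < m)%N by apply: leq_ltn_trans (poly_rank_singular det0).
  have [s [e [P [X [popP unitX trA]]]]] := popov_exists (t_trailing A) m_gt0.
  exists (Shift_rows (poly_rank (t_trailing A)) (map_mx const X *m A)).
  exact: (step_popov q0 det0 erefl popP unitX trA).
- right; have [s [e [P [popP trA]]]] := invA; have [B DA] := shift_exists trA.
  by exists (Reduce_rows r B); apply: (step_shift (e := e)); apply/shift_mxP.
right; have [s [e [P [C [[_ nzP _] trA]]]]] := invA.
(* The rows of C are divided one at a time and the quotients collected into a matrix. *)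
have [x Dx] : exists x : 'I_s -> 'rV[{poly K}]_r, forall i,
    exists z, row i C = x i *m P + z /\ ~ reducible P z.
  apply: (@fin_all_exists _ (fun=> 'rV[{poly K}]_r)
    (fun i x => exists z, row i C = x *m P + z /\ ~ reducible P z)) => i.
  exact: groebner_division.
pose X := \matrix_i x i; pose Y := C - X *m P.
have row_Y i : ~ reducible P (row i Y).
  have [z [Dz irr_z]] := Dx i.
  by rewrite raddfB /= row_mul rowK Dz addrC addKr.
have DC : C = X *m P + Y by rewrite addrC subrK.
by eexists; apply: (step_reduce q0 trA DC row_Y).
Qed.

(** Induction on accessibility: at every configuration either the run has returned or progress
    supplies a next one. *)
Lemma terminates_returns A0 c : terminates q0 c -> trace_inv A0 c ->
  exists B, reachable q0 c (Return B).
Proof.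
elim=> {}c _ IHc invc; case: (trace_inv_progress invc) => [[B ->] | [c' st]].
  by exists B; apply: rt_refl.
have [B ret] := IHc c' st (trace_inv_step st invc).
by exists B; apply: rt_trans ret; apply: rt_step.
Qed.

End Procedure.

Theorem theorem4p2 (K : fieldType) (char0 : [pchar K] =i pred0)
  (q : K) (q0 : q != 0)
  (q_not_root_of_unity : forall n : nat, (0 < n)%N -> q ^+ n != 1)
  (m : nat) (A : 'M[skew_t q]_m) (A_regular : regular_mx q0 A) :
  [/\ terminates q0 (Test_trailing A),
      forall c, reachable q0 (Test_trailing A) c ->
        (exists B, c = Return B) \/ (exists c', step q0 c c'),
      forall B, reachable q0 (Test_trailing A) (Return B) ->
        equivalent_mx q0 A B /\ \det (t_trailing B) != 0
    & exists B, reachable q0 (Test_trailing A) (Return B)].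
Proof.
have invA : trace_inv q0 A (Test_trailing A).
  by split=> //; apply: equivalent_mx_refl.
have termA : terminates q0 (Test_trailing A).
  (* A bound D for the input serves the whole run, and the independent family starts empty. *)
  have [D dA] := tdeg_mx_exists A.
  apply: (@bounded_config_terminates _ _ _ _ D 0); split=> //.
  exact: independent_family0.
split=> // [c /trace_inv_reachable/(_ invA) | B /trace_inv_reachable/(_ invA) [] // |].
  exact: trace_inv_progress.
exact: terminates_returns invA.
Qed.
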